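(* Let $S$ be one of $\emptyset$, $\{1\}$, $\{1,2\}$, $\{1,2,3\}$, and take as background knowledge the JCI Assumptions in $S$. Then the corresponding version of FCI-JCI is sound in the $\sigma$-separation setting without selection bias: for every (possibly cyclic) DMG $G$ with node set $\mathcal I\cup\mathcal K$ that satisfies the JCI Assumptions in $S$, the DPAG $\mathcal{P}_{\mathrm{FCI\text{-}JCI}}(\mathrm{IM}_\sigma(G))$ output by the version of FCI-JCI for $S$ contains $G$.
   Context: DMGs. A directed mixed graph (DMG) $G=\langle V,E,F\rangle$ has a finite node set $V$, directed edges $i\to j$ and bidirected edges $i\leftrightarrow j$ between distinct nodes; several edges between two nodes are allowed (at most one of each of $i\to j$, $i\leftarrow j$, $i\leftrightarrow j$). A walk is an alternating sequence of nodes and edges, each edge connecting consecutive nodes; a path is a walk containing each node at most once. $\mathrm{an}_G(j)$ is the set of nodes $i$ with a (possibly trivial) directed path $i\to\dots\to j$; $\mathrm{de}_G(i)=\{j:i\in\mathrm{an}_G(j)\}$; $\mathrm{sc}_G(i)=\mathrm{an}_G(i)\cap\mathrm{de}_G(i)$; $\mathrm{an}_G(I)=\bigcup_{i\in I}\mathrm{an}_G(i)$. A non-endpoint node on a walk is a collider if both adjacent walk edges have an arrowhead at it; other nodes on it are non-colliders. $\sigma$-separation. A walk is $\sigma$-blocked by $C\subseteq V$ if: its first or last node is in $C$; or it contains a collider not in $\mathrm{an}_G(C)$; or it contains a non-endpoint non-collider $k\in C$ with a directed walk edge $k\to l$ to a neighbouring node $l$ on the walk with $l\notin\mathrm{sc}_G(k)$.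 $A$ is $\sigma$-separated from $B$ by $C$ if all paths between nodes of $A$ and nodes of $B$ are $\sigma$-blocked by $C$. $\mathrm{IM}_\sigma(G)$ is the set of triples $\langle A,B,C\rangle$ of subsets of $V$ such that $A$ is $\sigma$-separated from $B$ by $C$. An inducing path between $i$ and $j$ in a DMG $G$ is a path between them on which every collider is in $\mathrm{an}_G(\{i,j\})$ and each non-endpoint non-collider only has outgoing directed edges (on the path) to neighbouring nodes on the path in the same strongly connected component of $G$. DPAGs. A directed partial ancestral graph (DPAG) is a mixed graph with edges of types $\to,\leftarrow,\leftrightarrow,\circ\!\!\to,\leftarrow\!\!\circ,\circ\!\!-\!\!\circ$, at most one edge between two distinct nodes, no self-cycles, no directed cycle and no almost directed cycle (directed path from $i$ to $j$ together with $j\leftrightarrow i$), and no inducing path between non-adjacent nodes (a path all of whose non-endpoint nodes are colliders on it and ancestors, via directed paths, of an endpoint). $*$ stands for any edge mark. A DPAG $P$ contains a DMG $G$ with the same node set if: (1) $i,j$ are adjacent in $P$ iff there is an inducing path between them in $G$; (2) $i\,*\!\!\to j$ in $P$ implies $j\notin\mathrm{an}_G(i)$; (3) $i\to j$ in $P$ implies $i\in\mathrm{an}_G(j)$. A path $v_0,\dots,v_n$ is possibly directed from $v_0$ to $v_n$ if each edge between $v_{m-1}$ and $v_m$ is $v_{m-1}\circ\!\!-\!\!\circ v_m$, $v_{m-1}\circ\!\!\to v_m$ or $v_{m-1}\to v_m$; it is uncovered if $v_{m-2},v_m$ are non-adjacent for $m=2,\dots,n$. JCI Assumptions. The node set is a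 disjoint union $V=\mathcal I\cup\mathcal K$ of system nodes $\mathcal I$ and context nodes $\mathcal K$. (1) Exogeneity: for all $k\in\mathcal K,i\in\mathcal I$: $i\to k\notin G$. (2) Randomization: for all $k\in\mathcal K,i\in\mathcal I$: $i\leftrightarrow k\notin G$. (3) Genericity: for all $k\neq k'\in\mathcal K$: $k\leftrightarrow k'\in G$ and $k\to k'\notin G$. FCI and FCI-JCI (without selection bias). Given an independence model $I$ (set of triples of subsets of $V$): distinct $i,j$ are adjacent iff there is no $Z\subseteq V\setminus\{i,j\}$ with $\langle\{i\},\{j\},Z\rangle\in I$; for non-adjacent $i,j$, $\mathrm{SepSet}(i,j)$ is one such $Z$ (chosen by a fixed rule). All edges start as $\circ\!\!-\!\!\circ$. R0: for every unshielded triple $\langle a,c,b\rangle$ ($a,c$ adjacent, $c,b$ adjacent, $a,b$ non-adjacent), orient $a\,*\!\!\to c\leftarrow\!\!*\,b$ iff $c\notin\mathrm{SepSet}(a,b)$. In FCI-JCI only, background orientations are then imposed: if $1\in S$, every edge between $k\in\mathcal K$ and $i\in\mathcal I$ is oriented $k\,*\!\!\to i$; if $\{1,2\}\subseteq S$, it is oriented $k\to i$; if $3\in S$, all $k\ne k'\in\mathcal K$ are adjacent and oriented $k\leftrightarrow k'$. (For $S=\emptyset$ this is FCI.) Then exhaustively R1–R4. R1: if $a\,*\!\!\to b\circ\!\!-\!\!*\,c$ with $a,c$ non-adjacent, orient $b\to c$. R2: if ($a\to b\,*\!\!\to c$ or $a\,*\!\!\to b\to c$) and $a\,*\!\!-\!\!\circ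 c$, orient $a\,*\!\!\to c$. R3: if $a\,*\!\!\to b\leftarrow\!\!*\,c$, $a\,*\!\!-\!\!\circ d\circ\!\!-\!\!*\,c$, $a,c$ non-adjacent and $d\,*\!\!-\!\!\circ b$, orient $d\,*\!\!\to b$. R4: if $\langle x,\dots,a,b,c\rangle$ is a discriminating path for $b$ (at least three edges, $x,c$ non-adjacent, every node strictly between $x$ and $b$ is a collider on the path and a parent of $c$) and $b\circ\!\!-\!\!*\,c$, orient $b\to c$ if $b\in\mathrm{SepSet}(x,c)$ and $a\leftrightarrow b\leftrightarrow c$ otherwise. Then exhaustively R8a, R9, R10. R8a: if $a\to b\to c$ and $a\circ\!\!\to c$, orient $a\to c$. R9: if $a\circ\!\!\to c$ and there is an uncovered possibly directed path $\langle a,b,\dots,c\rangle$ with $b,c$ non-adjacent, orient $a\to c$. R10: if $a\circ\!\!\to c$, $b\to c\leftarrow d$, and there are uncovered possibly directed paths $\langle a,m_1,\dots,b\rangle$ and $\langle a,m_2,\dots,d\rangle$ with $m_1,m_2$ distinct and non-adjacent, orient $a\to c$. *)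

(* Defs.v *)
From HB Require Import structures.
From Stdlib Require Import Relation_Operators.
From mathcomp Require Export all_boot.
From mathcomp Require Export boolp.

Set Implicit Arguments.
Unset Strict Implicit.
Unset Printing Implicit Defensive.

(** * Directed mixed graphs and sigma-separation *)

Record dmg (V : finType) := Dmg {
  dir : rel V;   (* [dir i j]: i -> j *)
  bid : rel V;   (* [bid i j]: i <-> j *)
  dir_irr : irreflexive dir;
  bid_irr : irreflexive bid;
  bid_sym : symmetric bid }.

(* How an edge of a walk is traversed, from u to the next node v:
   [Fwd] is u -> v, [Bwd] is u <- v, [Bid] is u <-> v.  A walk is its first
   node x together with the list of the subsequent (edge, node) pairs, so that
   parallel edges give different walks. *)
Inductive ekind := Fwd | Bwd | Bid.

Definition head_src (e : ekind) := if e is Fwd then false else true.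
Definition head_tgt (e : ekind) := if e is Bwd then false else true.

Section SigmaSeparation.
Variables (V : finType) (G : dmg V).
Implicit Types (i j k u v t x : V) (A B C : {set V}) (w : seq (ekind * V)).

Definition an j : {set V} := [set i | connect (dir G) i j].
Definition de i : {set V} := [set j | i \in an j].
Definition sc i : {set V} := an i :&: de i.
Definition anS C : {set V} := \bigcup_(j in C) an j.

Definition edge (e : ekind) u v : bool :=
  match e with Fwd => dir G u v | Bwd => dir G v u | Bid => bid G u v end.

Fixpoint walk x w : bool :=
  if w is (e, v) :: w' then edge e x v && walk v w' else true.

Definition wend x w : V := last x (unzip2 w).

Definition gpath x w : bool := walk x w && uniq (x :: unzip2 w).

(* The non-endpoint positions of a walk: previous node u, edge e1 from u to v,
   the node v itself, edge e2 from v to t, next node t. *)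
Fixpoint inner x w : seq (V * ekind * V * ekind * V) :=
  match w with
  | (e1, v) :: (((e2, t) :: _) as w') => (x, e1, v, e2, t) :: inner v w'
  | _ => [::]
  end.

Definition collider (e1 e2 : ekind) : bool := head_tgt e1 && head_src e2.

(* v has an outgoing directed walk edge to a neighbour on the walk outside its
   strongly connected component. *)
Definition exits_sc u (e1 : ekind) v (e2 : ekind) t : bool :=
  (if e1 is Bwd then u \notin sc v else false)
  || (if e2 is Fwd then t \notin sc v else false).

Definition sigma_blocked C x w : bool :=
  [|| x \in C, wend x w \in C |
      has (fun '(u, e1, v, e2, t) =>
             if collider e1 e2 then v \notin anS C
             else (v \in C) && exits_sc u e1 v e2 t) (inner x w)].

Definition sigma_separated A B C : Prop :=
  forall x w, gpath x w -> x \in A -> wend x w \in B -> sigma_blocked C x w.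

Definition inducing_path i j w : bool :=
  [&& gpath i w, wend i w == j &
      all (fun '(u, e1, v, e2, t) =>
             if collider e1 e2 then v \in anS [set i; j]
             else ~~ exits_sc u e1 v e2 t) (inner i w)].

End SigmaSeparation.

(* Sets of triples <A, B, C> of subsets of V. *)
Definition indep_model (V : finType) := {set {set V} * {set V} * {set V}}.

Definition IM_sigma (V : finType) (G : dmg V) : indep_model V :=
  [set t | `[< sigma_separated G t.1.1 t.1.2 t.2 >]].

(** * Partial ancestral graphs *)

Inductive mark := Circle | Arrow | Tail.

Definition mark_eq (m n : mark) : bool :=
  match m, n with
  | Circle, Circle | Arrow, Arrow | Tail, Tail => true
  | _, _ => false
  end.
Lemma mark_eqP : Equality.axiom mark_eq.
Proof. by case; case; constructor. Qed.
HB.instance Definition _ := hasDecEq.Build mark mark_eqP.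

(* [P u v] is the mark at v of the edge between u and v, and [None] when u and
   v are not adjacent. *)
Definition pgraph (V : finType) := V -> V -> option mark.

Fixpoint triples (T : Type) (s : seq T) : seq (T * T * T) :=
  match s with
  | a :: ((b :: c :: _) as s') => (a, b, c) :: triples s'
  | _ => [::]
  end.

Section PartialAncestralGraphs.
Variables (V : finType) (P : pgraph V).
Implicit Types (a b c d i j u v x : V) (p q s : seq V).

Definition adj i j : bool := P i j != None.
Definition nonadj i j : bool := (i != j) && ~~ adj i j.

Definition into i j : bool := P i j == Some Arrow.           (* i *-> j *)
Definition circ i j : bool := P i j == Some Circle.          (* i *-o j *)
Definition pdir i j : bool := into i j && (P j i == Some Tail). (* i -> j *)
Definition pbid i j : bool := into i j && into j i.          (* i <-> j *)
Definition ocirc i j : bool := circ i j && circ j i.         (* i o-o j *)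
Definition oarrow i j : bool := into i j && circ j i.        (* i o-> j *)

(* Every non-endpoint node of the path with node sequence s is a collider. *)
Definition collider_seq s : bool :=
  all (fun '(u, v, t) => into u v && into t v) (triples s).

Definition pag_inducing_path i j p : bool :=
  [&& path adj i p, uniq (i :: p), last i p == j, collider_seq (i :: p) &
      all (fun '(_, v, _) => connect pdir v i || connect pdir v j)
          (triples (i :: p))].

Definition is_dpag : Prop :=
  [/\ [/\ forall i, P i i = None,
          forall i j, adj i j = adj j i
        & forall i j, adj i j ->
            [|| pdir i j, pdir j i, pbid i j, oarrow i j, oarrow j i
              | ocirc i j]],
      (forall i j, connect pdir i j -> ~~ pdir j i),
      (forall i j, connect pdir i j -> ~~ pbid j i)
    & forall i j p, nonadj i j -> ~~ pag_inducing_path i j p].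

Definition contains (G : dmg V) : Prop :=
  [/\ forall i j, i != j -> (adj i j <-> exists w, inducing_path G i j w),
      forall i j, into i j -> j \notin an G i
    & forall i j, pdir i j -> i \in an G j].

Definition possdir i j : bool := [|| ocirc i j, oarrow i j | pdir i j].

Definition uncovered_possdir_path a p : bool :=
  [&& path possdir a p, uniq (a :: p) &
      all (fun '(u, _, t) => nonadj u t) (triples (a :: p))].

(* The node sequence of the path is x :: q ++ [:: b; c]; the node a preceding
   b is [last x q]. *)
Definition discriminating_path x q b c : bool :=
  [&& q != [::], path adj x (q ++ [:: b; c]), uniq (x :: q ++ [:: b; c]),
      nonadj x c, collider_seq (x :: rcons q b) & all (pdir^~ c) q].

End PartialAncestralGraphs.

(** * JCI assumptions *)

Inductive jci := Exogeneity | Randomization | Genericity.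

Definition jci_eq (a b : jci) : bool :=
  match a, b with
  | Exogeneity, Exogeneity | Randomization, Randomization
  | Genericity, Genericity => true
  | _, _ => false
  end.
Lemma jci_eqP : Equality.axiom jci_eq.
Proof. by case; case; constructor. Qed.
HB.instance Definition _ := hasDecEq.Build jci jci_eqP.

(* K is the set of context nodes; the system nodes are those outside K. *)
Definition jci_sat (V : finType) (K : {set V}) (G : dmg V) (a : jci) : Prop :=
  match a with
  | Exogeneity => forall k i, k \in K -> i \notin K -> ~~ dir G i k
  | Randomization => forall k i, k \in K -> i \notin K -> ~~ bid G i k
  | Genericity => forall k k', k \in K -> k' \in K -> k != k' ->
                    bid G k k' && ~~ dir G k k'
  end.

(** * The FCI-JCI algorithm *)

Section FCI.
Variables (V : finType) (I : indep_model V).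

Definition fci_adj (i j : V) : bool :=
  (i != j) &&
  [forall Z : {set V},
     (Z \subset ~: [set i; j]) ==> (([set i], [set j], Z) \notin I)].

Definition is_sepset (sep : V -> V -> {set V}) : Prop :=
  forall i j, i != j -> ~~ fci_adj i j ->
    sep i j \subset ~: [set i; j] /\ ([set i], [set j], sep i j) \in I.

Definition skeleton : pgraph V :=
  fun i j => if fci_adj i j then Some Circle else None.

Variable sep : V -> V -> {set V}.

Definition R0 (P : pgraph V) : pgraph V := fun a c =>
  (* [sep] need not be symmetric: <a, c, b> and <b, c, a> both count. *)
  if [exists b, [&& adj P a c, adj P c b, nonadj P a b
                  & (c \notin sep a b) || (c \notin sep b a)]]
  then Some Arrow else P a c.

Definition background (S : seq jci) (K : {set V}) (P : pgraph V) : pgraph V :=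
  fun u v =>
    if [&& Genericity \in S, u \in K, v \in K & u != v] then Some Arrow
    else if adj P u v && (Exogeneity \in S) then
      if (u \in K) && (v \notin K) then Some Arrow
      else if [&& Randomization \in S, u \notin K & v \in K] then Some Tail
      else P u v
    else P u v.

Definition set_mark (P : pgraph V) (a b : V) (m : mark) : pgraph V :=
  fun u v => if (u == a) && (v == b) then Some m else P u v.

Definition orient_dir (P : pgraph V) (a b : V) : pgraph V :=
  set_mark (set_mark P a b Arrow) b a Tail.

Definition orient_bid (P : pgraph V) (a b : V) : pgraph V :=
  set_mark (set_mark P a b Arrow) b a Arrow.

Inductive rule1_4 (P : pgraph V) : pgraph V -> Prop :=
| R1 a b c : into P a b -> circ P c b -> nonadj P a c ->
    rule1_4 P (orient_dir P b c)
| R2 a b c : pdir P a b && into P b c || into P a b && pdir P b c ->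
    circ P a c ->
    rule1_4 P (set_mark P a c Arrow)
| R3 a b c d : into P a b -> into P c b -> circ P a d -> circ P c d ->
    nonadj P a c -> circ P d b ->
    rule1_4 P (set_mark P d b Arrow)
| R4_noncollider x q b c : discriminating_path P x q b c -> circ P c b ->
    b \in sep x c ->
    rule1_4 P (orient_dir P b c)
| R4_collider x q b c : discriminating_path P x q b c -> circ P c b ->
    b \notin sep x c ->
    rule1_4 P (orient_bid (orient_bid P (last x q) b) b c).

Inductive rule8_10 (P : pgraph V) : pgraph V -> Prop :=
| R8a a b c : pdir P a b -> pdir P b c -> oarrow P a c ->
    rule8_10 P (orient_dir P a c)
| R9 a b c p : oarrow P a c -> uncovered_possdir_path P a (b :: p) ->
    last b p = c -> nonadj P b c ->
    rule8_10 P (orient_dir P a c)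
| R10 a b c d m1 p1 m2 p2 : oarrow P a c -> pdir P b c -> pdir P d c ->
    uncovered_possdir_path P a (m1 :: p1) -> last m1 p1 = b ->
    uncovered_possdir_path P a (m2 :: p2) -> last m2 p2 = d ->
    nonadj P m1 m2 ->
    rule8_10 P (orient_dir P a c).

Definition exhaust (rule : pgraph V -> pgraph V -> Prop) (P P' : pgraph V) :=
  clos_refl_trans _ rule P P' /\ forall P'', ~ rule P' P''.

(* P is the output of a run, for some order of rule applications. *)
Definition fci_jci (S : seq jci) (K : {set V}) (P : pgraph V) : Prop :=
  exists P1, exhaust rule1_4 (background S K (R0 skeleton)) P1
             /\ exhaust rule8_10 P1 P.

End FCI.

(* Main.v *)
From Stdlib Require Import Relation_Operators.
Require Import Defs.

Set Implicit Arguments.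
Unset Strict Implicit.
Unset Printing Implicit Defensive.

(** The proof works directly in the cyclic graph, without passing to an
    acyclification.

    What matters of a walk at a node are the two edge ends there, and of an edge
    end only whether it is an arrowhead, a tail whose edge stays in the strongly
    connected component of the node, or a tail whose edge leaves it.  Up to
    these marks, sigma-open walks and inducing paths are two instances of one
    notion ([trail]): colliders must lie in a set closed under ancestors, and
    non-colliders with a leaving tail in another set.  Loops of such a walk can
    be cut out ([path_of_trail]), so open walks already refute separation, and
    two nodes are adjacent iff an inducing path joins them ([trail_adj],
    [adj_inducing_path]).

    Three facts about adjacent nodes carry all orientation rules.  First, an
    inducing path yields a walk that is open given any set [Z], and that keeps
    its marks at the endpoints in [Z] ([open_inducing]).  Secondly, an inducing
    path to a non-ancestor can be chosen to arrive there with an arrowhead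
    ([inducing_trail_head]), and then it can be prolonged inside the component
    of its end ([adj_sc]).  This is what replaces acyclicity: where the acyclic
    argument concludes from [b] being an ancestor of [c] that [c] is none of
    [b], here [c] would lie in the component of [b] and so be adjacent to nodes
    it is not adjacent to.  Thirdly, an open walk can be continued along an
    adjacency at a node outside of [Z] that is an ancestor of [Z] or of one of
    the two outer nodes ([extend_nsep]).  Hence the middle node of an unshielded
    triple is an ancestor of one of its ends if it belongs to their separating
    set, and of neither otherwise.

    An arrowhead therefore means non-ancestor and a tail means ancestor at every
    stage of a run ([sound]): both for the background knowledge, by a look at
    how an inducing path leaves the context, and for each rule.  Once all marks
    are correct, a directed or almost directed cycle in the output would
    contradict itself, and an inducing path in the output would concatenate, at
    its colliders, inducing paths of the graph into one between non-adjacent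
    nodes.  Runs end since every rule removes a circle and adds none. *)

(** * Walks through edge-end marks *)

(** What an edge looks like from one of its endpoints: an arrowhead, or a tail
    whose edge stays in, respectively leaves, the strongly connected component
    of that endpoint.  Blocking and inducing conditions at a node only depend
    on the two marks that the walk has there. *)
Inductive endmark := Head | Stay | Exit.

Definition is_head m := if m is Head then true else false.

Section Trails.
Variables (V : finType) (G : dmg V).
Implicit Types (a b c i j u v t x y z : V) (A N Z : {set V}).
Implicit Types (w : seq (ekind * V)) (m k : endmark).

Lemma anE i j : (i \in an G j) = connect (dir G) i j.
Proof. by rewrite inE. Qed.

Lemma an_refl i : i \in an G i.
Proof. by rewrite anE connect0. Qed.

Lemma an_trans j i u : i \in an G j -> j \in an G u -> i \in an G u.
Proof. by rewrite !anE; apply: connect_trans. Qed.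

Lemma dir_an i j : dir G i j -> i \in an G j.
Proof. by rewrite anE; apply: connect1. Qed.

Lemma scE i j : (j \in sc G i) = (j \in an G i) && (i \in an G j).
Proof. by rewrite /sc /de !inE. Qed.

Lemma anSP Z i : reflect (exists2 j, j \in Z & i \in an G j) (i \in anS G Z).
Proof. exact: bigcupP. Qed.

Lemma anS_an Z i j : i \in an G j -> j \in anS G Z -> i \in anS G Z.
Proof.
by move=> ij /anSP[k kZ jk]; apply/anSP; exists k => //; apply: an_trans jk.
Qed.

Lemma mem_anS Z i : i \in Z -> i \in anS G Z.
Proof. by move=> iZ; apply/anSP; exists i => //; apply: an_refl. Qed.

Lemma anS2 a b i : (i \in anS G [set a; b]) = (i \in an G a) || (i \in an G b).
Proof.
apply/anSP/orP=> [[j /set2P[]-> ->]|[]]; [by left|by right| |].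
- by exists a; rewrite ?set21.
- by exists b; rewrite ?set22.
Qed.

Definition smark (e : ekind) u v :=
  if head_src e then Head else if v \in sc G u then Stay else Exit.
Definition tmark (e : ekind) u v :=
  if head_tgt e then Head else if u \in sc G v then Stay else Exit.

Definition link x m m' y :=
  exists e, [/\ edge G e x y, m = smark e x y & m' = tmark e x y].

Lemma link_sym x m m' y : link x m m' y -> link y m' m x.
Proof.
case=> -[] [E -> ->]; [exists Bwd|exists Fwd|exists Bid]; split=> //.
by rewrite /= bid_sym.
Qed.

Lemma link_dir u v : dir G u v -> link u (smark Fwd u v) Head v.
Proof. by exists Fwd. Qed.

Lemma link_neq x m m' y : link x m m' y -> x != y.
Proof.
by case=> -[] [/= E _ _]; apply: contraTneq E => ->; rewrite ?dir_irr ?bid_irr.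
Qed.

Variant link_tail_spec x m m' y : Prop :=
  LinkTail of m' = Head & dir G x y & m = smark Fwd x y.

Lemma link_tail x m m' y :
  link x m m' y -> ~~ is_head m -> link_tail_spec x m m' y.
Proof. by case=> -[] [/= E -> ->]. Qed.

Lemma smark_tail u v : ~~ is_head (smark Fwd u v).
Proof. by rewrite /smark /=; case: ifP. Qed.

(** The condition on an inner node, with [A] the nodes allowed as colliders and
    [N] the nodes allowed as non-colliders that leave their component. *)
Definition pass A N v m m' : bool :=
  match m, m' with
  | Head, Head => v \in A
  | Exit, _ | _, Exit => v \in N
  | _, _ => true
  end.

Lemma passC A N v m m' : pass A N v m m' = pass A N v m' m.
Proof. by case: m; case: m'. Qed.

Lemma pass_N A N v m m' :
  v \in N -> ~~ (is_head m && is_head m') -> pass A N v m m'.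
Proof. by move=> vN; case: m; case: m'. Qed.

(** A nonempty walk, of which only the endpoints and the marks at them are
    remembered. *)
Inductive trail A N x m : endmark -> V -> Prop :=
| trail_link m' y : link x m m' y -> trail A N x m m' y
| trail_snoc m1 y m2 m' z : trail A N x m m1 y -> pass A N y m1 m2 ->
    link y m2 m' z -> trail A N x m m' z.

Lemma trail_cat A N x m m1 y m2 m' z :
  trail A N x m m1 y -> pass A N y m1 m2 -> trail A N y m2 m' z ->
  trail A N x m m' z.
Proof.
move=> T py; elim=> [k v L|k v k' l u _ IH pv L]; last exact: trail_snoc IH pv L.
exact: trail_snoc T py L.
Qed.

Lemma trail_sym A N x m m' y : trail A N x m m' y -> trail A N y m' m x.
Proof.
elim=> [k v /link_sym L|k v k' l u _ IH pv /link_sym L]; first exact: trail_link.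
by apply: trail_cat IH; [apply: trail_link L|rewrite passC].
Qed.

Lemma sub_trail A A' N N' x m m' y : A \subset A' -> N \subset N' ->
  trail A N x m m' y -> trail A' N' x m m' y.
Proof.
move=> /subsetP sA /subsetP sN; elim=> [k v L|k v k' l u _ IH pv L].
  exact: trail_link.
by apply: trail_snoc IH _ L; move: pv; case: k; case: k' => /=; auto.
Qed.

Lemma directed_trail A N x y : x \in an G y -> x != y ->
  (forall u v, x \in an G u -> dir G u v -> v \in an G y ->
     (u \in N) || (v \in sc G u)) ->
  exists t, [/\ dir G x t, t \in an G y & trail A N x (smark Fwd x t) Head y].
Proof.
rewrite {1}anE => /connectP[[|t p] /= xp yE] xy ok; first by rewrite yE eqxx in xy.
case/andP: xp => xt tp; exists t; split=> //.
  by rewrite anE; apply/connectP; exists p.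
move: yE ok tp; elim/last_ind: p y {xy} => [|p z IH] y /= yE ok tp.
  by rewrite yE; apply/trail_link/link_dir.
move: tp yE; rewrite rcons_path last_rcons => /andP[tp uz] yE; subst y.
have xu : x \in an G (last t p).
  by apply: an_trans (dir_an xt) _; rewrite anE; apply/connectP; exists p.
apply: (@trail_snoc _ _ _ _ Head (last t p) (smark Fwd (last t p) z)).
- apply: IH => // u v xu' uv vl; apply: ok => //.
  exact: an_trans vl (dir_an uz).
- move: (ok _ _ xu uz (an_refl z)); rewrite /smark /=.
  by case: ifP; rewrite ?orbF.
- exact: link_dir.
Qed.

(** Inside a component a directed path meets no condition at all, so a walk
    that arrives with an arrowhead at one node of a component can be extended
    to any other. *)
Lemma sc_trail A N x y : y \in sc G x -> x != y -> trail A N x Stay Head y.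
Proof.
rewrite scE => /andP[yx xy] nxy.
have [u v xu uv vy|t [xt ty T]] := @directed_trail A N x y xy nxy.
  by rewrite scE (dir_an uv) (an_trans vy (an_trans yx xu)) orbT.
have : t \in sc G x by rewrite scE (dir_an xt) (an_trans ty yx).
by move=> tsc; suff <- : smark Fwd x t = Stay by []; rewrite /smark tsc.
Qed.

(** Leaving a tail, a walk follows directed edges until it meets a collider or
    its other end. *)
Lemma trail_tail A N x m m' y : (forall u v, dir G u v -> v \in A -> u \in A) ->
  trail A N x m m' y -> ~~ is_head m' ->
  exists u, [/\ dir G y u, m' = smark Fwd y u & (u \in an G x) || (u \in A)].
Proof.
move=> clA; elim=> [k v /link_sym L|k v k' l u _ IH pv /link_sym L] tl.
  by case: (link_tail L tl) => _ vx ->; exists x; rewrite an_refl.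
case: (link_tail L tl) => k'E uv ->; exists v; split=> //.
rewrite k'E in pv; case: (boolP (is_head k)) => [kh|kt].
  by case: k kh pv {IH} => //= _ ->; rewrite orbT.
have [u' [vu' _ /orP[u'x|u'A]]] := IH kt.
  by rewrite (an_trans (dir_an vu') u'x).
by rewrite (clA _ _ vu' u'A) orbT.
Qed.

(** * From walks to paths *)

(** [m] stands for a mark with which the walk [w] enters its first node. *)
Fixpoint passes A N m x w : bool :=
  if w is (e, v) :: w' then
    [&& edge G e x v, pass A N x m (smark e x v) & passes A N (tmark e x v) v w']
  else true.

Lemma passes_inner A N m x w : passes A N m x w ->
  walk G x w && all (fun '(u, e1, v, e2, t) =>
     pass A N v (tmark e1 u v) (smark e2 v t)) (inner x w).
Proof.
elim: w m x => //= -[e v] w IH m x /and3P[-> _ /[dup] pw /IH/andP[-> IH2]] /=.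
by case: w pw {IH} IH2 => [|[e2 t] w] //= /and3P[_ -> _] ->.
Qed.

Lemma trail_of_walk A N x e v w : walk G x ((e, v) :: w) ->
  all (fun '(u, e1, v, e2, t) => pass A N v (tmark e1 u v) (smark e2 v t))
      (inner x ((e, v) :: w)) ->
  exists m, trail A N x (smark e x v) m (wend x ((e, v) :: w)).
Proof.
elim: w x e v => [|[e' t] w IH] x e v.
  by rewrite /= andbT => E _; exists (tmark e x v); apply: trail_link; exists e.
move=> /= /andP[E W] /andP[p al].
have [m T] := IH v e' t W al; exists m.
by apply: trail_cat T; [apply: trail_link; exists e|].
Qed.

(** The suffix of a path from one of its nodes [x].  If the path is entered
    with an arrowhead and [x] is left towards its start by a tail, then [x] is
    an ancestor of some collider in between. *)
Lemma passes_suffix A N m v w x : (forall a b, dir G a b -> b \in A -> a \in A) ->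
  passes A N m v w -> uniq (v :: unzip2 w) -> x \in unzip2 w ->
  exists m0 w0, [/\ passes A N m0 x w0, wend x w0 = wend v w,
    uniq (x :: unzip2 w0) &
    is_head m || (v \in A) -> ~~ is_head m0 -> x \in A].
Proof.
move=> clA; elim: w m v => //= -[e t] w IH m v /= /and3P[E pv pw] /andP[_ uw].
have L : link t (tmark e v t) (smark e v t) v by apply: link_sym; exists e.
(* A tail at [t] points to [v], which lies in [A]: as a collider of the walk
   if it was entered with an arrowhead. *)
have back : is_head m || (v \in A) -> ~~ is_head (tmark e v t) -> t \in A.
  move=> hv tl; case: (link_tail L tl) => sE tv _; apply: (clA _ _ tv).
  by case/orP: hv => // hm; move: hm pv; rewrite sE; case: m.
rewrite inE => /orP[/eqP xE|xw].
  by subst x; exists (tmark e v t), w.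
have [m0 [w0 [P0 E0 U0 H0]]] := IH _ _ pw uw xw.
exists m0, w0; split=> // hv; apply: H0.
by case: (boolP (is_head _)) => //=; apply: back.
Qed.

Lemma pass_cut A N x k l m s : pass A N x k l -> pass A N x m s ->
  (~~ is_head m -> ~~ is_head l -> x \in A) -> pass A N x k s.
Proof.
by case: k; case: s; case: l; case: m => //= _ _; apply.
Qed.

(** Loops of a walk can be cut out.  The only danger is to turn a node into a
    collider, and then it already has a collider among its descendants.  The
    last clause says that the path may start by any mark that the trail may. *)
Lemma path_of_trail A N x m m' y : (forall a b, dir G a b -> b \in A -> a \in A) ->
  trail A N y m m' x ->
  exists w, [/\ uniq (x :: unzip2 w), wend x w = y &
    forall k, pass A N x k m' -> passes A N k x w].
Proof.
move=> clA; elim=> [k v /link_sym L|k v k' l u _ [w [U <- P]] pv /link_sym L].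
  have [e [E -> _]] := L; exists [:: (e, y)]; split=> //=.
    by rewrite inE (link_neq L).
  by move=> k0 ->; rewrite E.
have nuv := link_neq L.
have Pw : passes A N k' v w by apply: P; rewrite passC.
have [uw|uw] := boolP (u \in unzip2 w).
  have [m0 [w0 [P0 E0 U0 H0]]] := passes_suffix clA Pw U uw.
  exists w0; split=> // k0 pu; case: w0 {E0 U0} P0 => //= -[e t] w0.
  case/and3P=> -> p0 ->; rewrite andbT /=.
  apply: pass_cut pu p0 _ => m0t lt.
  by apply: H0 => //; case: (link_tail L lt) => ->.
have [e [E lE kE]] := L.
exists ((e, v) :: w); split=> //=.
  by move: U; rewrite /= inE negb_or nuv uw.
by move=> k0 pu; rewrite E -lE pu -kE.
Qed.

(** * Adjacency *)

Lemma passE A N u e1 v e2 t : pass A N v (tmark e1 u v) (smark e2 v t) =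
  if collider e1 e2 then v \in A else (v \in N) || ~~ exits_sc G u e1 v e2 t.
Proof.
rewrite /tmark /smark /exits_sc.
by case: e1; case: e2; case: (u \in sc G v); case: (t \in sc G v) => /=;
  rewrite ?orbT ?orbF.
Qed.

Notation open_trail Z := (trail (anS G Z) (~: Z)).
Notation inducing_trail a b := (trail (anS G [set a; b]) set0).

Lemma anS_closed Z u v : dir G u v -> v \in anS G Z -> u \in anS G Z.
Proof. by move=> /dir_an; apply: anS_an. Qed.

Lemma open_trail_nsep Z x m m' y : open_trail Z x m m' y ->
  x \notin Z -> y \notin Z -> ~ sigma_separated G [set x] [set y] Z.
Proof.
move=> /trail_sym T xZ yZ.
have [w [U E P]] := path_of_trail (@anS_closed Z) T.
(* A tail that stays in its component imposes nothing on x itself. *)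
have /P/passes_inner/andP[W al] : pass (anS G Z) (~: Z) x Stay m.
  by apply: pass_N; rewrite ?inE.
move=> /(_ x w); rewrite /gpath W U E !set11 => /(_ isT isT isT).
rewrite /sigma_blocked E (negPf xZ) (negPf yZ) /=; apply/negP.
rewrite -all_predC; apply: sub_all al => -[[[[u e1] v] e2] t] /=.
by rewrite passE; case: ifP => _ /=; rewrite ?negbK // inE negb_and.
Qed.

Lemma nsep_path Z x y : ~ sigma_separated G [set x] [set y] Z ->
  exists w, [/\ gpath G x w, wend x w = y & ~~ sigma_blocked G Z x w].
Proof.
move=> ns; apply: contrapT => H; apply: ns => x0 w gp /set1P xE /set1P yE.
by subst x0; apply: contrapT => /negP nb; apply: H; exists w.
Qed.

Lemma inducing_path_trail i j w : i != j -> inducing_path G i j w ->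
  exists m m', inducing_trail i j i m m' j.
Proof.
move=> ij /and3P[/andP[W _] /eqP E al]; case: w W E al => [|[e v] w] W E al.
  by case/eqP: ij.
have [|m T] := trail_of_walk (A := anS G [set i; j]) (N := set0) W.
  apply: sub_all al => -[[[[u e1] v1] e2] t].
  by rewrite passE inE; case: ifP.
by exists (smark e i v), m; rewrite -[X in trail _ _ _ _ _ X]E.
Qed.

(** An inducing path is open given any set that avoids its endpoints: a
    collider that is no ancestor of the set has a directed path to an endpoint
    that avoids the set, and this path replaces the part of the walk on that
    side.  At an endpoint that lies in the set no such detour arises, so the
    mark there survives; this lets inducing paths be glued at colliders. *)
Lemma open_inducing Z a m m' b : inducing_trail a b a m m' b ->
  exists k k', [/\ open_trail Z a k k' b, a \in Z -> k = m & b \in Z -> k' = m'].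
Proof.
pose detour k k' := [/\ open_trail Z a k k' b, a \in Z -> k = m & b \notin Z].
suff H y l : inducing_trail a b a m l y ->
    (exists2 k, open_trail Z a k l y & a \in Z -> k = m) \/
    (exists k k', detour k k').
  by case/H=> [[k T ka]|[k [k' [T ka bZ]]]]; [exists k, m'|exists k, k'];
    split=> //; rewrite (negPf bZ).
elim=> [l' v L|l' v l1 l2 u _ IH pv L]; first by left; exists m => //; left.
case: IH => [[k T ka]|]; last by right.
have [hh|nhh] := boolP (is_head l' && is_head l1); last first.
  left; exists k => //; apply: trail_snoc T _ L.
  by case: l' l1 pv nhh => [||] [||] //=; rewrite inE.
have {hh} [l'H l1H] : l' = Head /\ l1 = Head by case: l' l1 hh {T pv L} => [||] [||].
subst l' l1; have [vZ|vZ] := boolP (v \in anS G Z).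
  by left; exists k => //; apply: trail_snoc T _ L.
have free c u' v' : v \in an G u' -> dir G u' v' -> v' \in an G c ->
    (u' \in ~: Z) || (v' \in sc G u').
  by move=> vu' _ _; rewrite inE; apply/orP; left; apply: contra vZ => /mem_anS;
    apply: anS_an.
move: pv; rewrite /= anS2 => /orP[va|vb].
  left; have [vE|nva] := eqVneq v a.
    subst v; exists Head; first exact: trail_link.
    by move/(mem_anS)=> aZ; rewrite aZ in vZ.
  have [t [_ _ /trail_sym D]] := directed_trail (anS G Z) va nva (free a).
  exists Head; first apply: trail_snoc D _ L.
    by apply: pass_N; rewrite ?andbF ?(negPf (smark_tail _ _)) // inE;
      apply: contra vZ; apply: mem_anS.
  by move=> aZ; case/negP: vZ; apply/anSP; exists a.
right; have [vE|nvb] := eqVneq v b.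
  by subst v; exists k, Head; split=> //; apply: contra vZ; apply: mem_anS.
have [t [_ _ D]] := directed_trail (anS G Z) vb nvb (free b).
exists k, Head; split=> //; last by apply: contra vZ => bZ; apply/anSP; exists b.
apply: trail_cat T _ D; apply: pass_N; rewrite ?(negPf (smark_tail _ _)) // inE.
by apply: contra vZ; apply: mem_anS.
Qed.

Lemma trail_adj a m m' b : a != b -> inducing_trail a b a m m' b ->
  fci_adj (IM_sigma G) a b.
Proof.
move=> ab T; rewrite /fci_adj ab; apply/forallP => Z; apply/implyP => /subsetP sZ.
have [k [k' [O _ _]]] := open_inducing Z T.
have nZ x : x \in [set a; b] -> x \notin Z.
  by move=> xab; apply: contraL xab => /sZ; rewrite inE.
rewrite inE; apply/asboolP => /=.
by apply: open_trail_nsep O _ _; apply: nZ; rewrite ?set21 ?set22.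
Qed.

(** The ancestors of the endpoints form a universal candidate for separation:
    on a path that is open given them all inner nodes are such ancestors, since
    a tail leads along directed edges to a collider or an endpoint, and hence
    no inner non-collider leaves its component. *)
Lemma adj_inducing_path a b : fci_adj (IM_sigma G) a b ->
  exists w, inducing_path G a b w.
Proof.
pose B := anS G [set a; b]; pose Z := B :\: [set a; b].
case/andP=> _ /forallP/(_ Z); rewrite {1}/Z setDE subsetIr /= inE /=.
move=> /asboolPn/nsep_path[w [gp E]]; rewrite /sigma_blocked !negb_or.
case/and3P=> _ _; rewrite -all_predC => nb; exists w.
rewrite /inducing_path gp E eqxx /=; case/andP: gp => W U.
have ZB : {subset anS G Z <= B}.
  by move=> x /anSP[y]; rewrite inE => /andP[_ yB] /anS_an; apply.
have aB : a \in B by rewrite mem_anS ?set21.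
have bB : b \in B by rewrite mem_anS ?set22.
pose blocks := fun '(u, e1, v, e2, t) =>
  if collider e1 e2 then v \notin anS G Z else (v \in Z) && exits_sc G u e1 v e2 t.
have fwd x v w' : walk G x ((Fwd, v) :: w') -> last v (unzip2 w') = b ->
    all (predC blocks) (inner x ((Fwd, v) :: w')) -> x \in B.
  elim: w' x v => [|[e t] w' IH] x v /= /andP[xv W'].
    by move=> /= vb _; apply: anS_closed xv _; rewrite vb.
  move=> E' /andP[c al]; apply: anS_closed xv _.
  by case: e c W' al => /= [_|/negPn/ZB //|/negPn/ZB //] W' al; apply: IH al.
have ind w' x e v : walk G x ((e, v) :: w') -> last v (unzip2 w') = b ->
    a \notin v :: unzip2 w' -> uniq (v :: unzip2 w') -> (e = Bwd -> v \in B) ->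
    all (predC blocks) (inner x ((e, v) :: w')) ->
  all (fun '(u, e1, v, e2, t) => if collider e1 e2 then v \in B
     else ~~ exits_sc G u e1 v e2 t) (inner x ((e, v) :: w')).
  elim: w' x e v => //= -[e2 t] w' IH x e v /= /andP[xv W'] E' av.
  case/andP=> vw U' vB /andP[nbv nb']; move: av; rewrite inE negb_or => /andP[av aw].
  have vb : v != b by apply: contraNneq vw => ->; rewrite -E' mem_last.
  apply/andP; split; last first.
    apply: IH => // e2B; move: W' nbv; rewrite e2B => /andP[/anS_closed tv _].
    by case: e vB {xv} => /= [_ /negPn/ZB/tv //|/(_ erefl)/tv|_ /negPn/ZB/tv].
  case: ifP nbv => [_ /negPn/ZB //|col]; rewrite negb_and => /orP[|//].
  rewrite inE (_ : v \in B) ?andbT ?negbK.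
    by case/set2P=> vE; move: av vb; rewrite vE eqxx.
  case: e col vB {xv} => [col _|_ /(_ erefl) //|col _].
  - by case: e2 col W' nb' => //= _ W' nb'; apply: fwd W' _ nb'.
  - by case: e2 col W' nb' => //= _ W' nb'; apply: fwd W' _ nb'.
case: w W U E nb => // -[e v] w W /andP[av U] E nb; apply: ind => //.
by move=> eB; move: W; rewrite eB => /andP[/anS_closed+ _]; apply.
Qed.

Notation adjacent := (fci_adj (IM_sigma G)).

Lemma adj_neq a b : adjacent a b -> a != b.
Proof. by case/andP. Qed.

Lemma adj_trail a b : adjacent a b -> exists m m', inducing_trail a b a m m' b.
Proof.
move=> ab; have [w] := adj_inducing_path ab.
exact: inducing_path_trail (adj_neq ab).
Qed.

Lemma adj_sym a b : adjacent a b = adjacent b a.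
Proof.
suff H x y : adjacent x y -> adjacent y x by apply/idP/idP; apply: H.
move=> xy; have [m [m' /trail_sym T]] := adj_trail xy.
by apply: (trail_adj _ (m := m') (m' := m)); rewrite 1?eq_sym ?adj_neq // setUC.
Qed.

(** An inducing path to a non-ancestor [b] of [a] can be made to end with an
    arrowhead at [b]: at the first node of the component of [b] it has an
    arrowhead, as a tail would leave the component, and from there the path can
    go to [b] inside the component. *)
Lemma inducing_trail_head a b m m' : inducing_trail a b a m m' b ->
  b \notin an G a -> inducing_trail a b a m Head b.
Proof.
move=> T ba.
have asc : a \notin sc G b by rewrite scE negb_and ba orbT.
suff enter y l : inducing_trail a b a m l y -> y \in sc G b ->
    inducing_trail a b a m Head b \/ l = Exit.
  have [|//|m'E] := enter _ _ T; first by rewrite scE an_refl.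
  have [|u [bu uE]] := trail_tail (@anS_closed _) T; rewrite ?m'E //.
  rewrite anS2 => /orP[ua|/orP[ua|ub]];
    try by rewrite (an_trans (dir_an bu) ua) in ba.
  by move: uE; rewrite m'E /smark /= scE ub (dir_an bu).
have last_link k u y' l' : u \notin sc G b -> y' \in sc G b ->
    inducing_trail a b a m l' y' -> link u k l' y' ->
    inducing_trail a b a m Head b \/ l' = Exit.
  move=> usc ysc T' /link_sym L.
  case: (boolP (is_head l')) => [hl|tl]; [left|right].
    case: l' hl T' {L} => // _ T'.
    have [yb|nyb] := eqVneq y' b; first by subst y'.
    apply: trail_cat T' _ (sc_trail _ _ _ nyb) => //.
    by move: ysc; rewrite !scE andbC.
  case: (link_tail L tl) => _ yu ->; rewrite /smark /=; case: ifP => // uy.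
  case/negP: usc; move: uy ysc; rewrite !scE => /andP[uy yu'] /andP[yb by'].
  by rewrite (an_trans uy yb) (an_trans by' yu').
elim=> [l' v L|l' v l1 l2 u T' IH pv L] usc.
  exact: last_link asc usc (trail_link _ _ L) L.
have [vsc|vsc] := boolP (v \in sc G b).
  by case: (IH vsc) => [|lE]; [left|move: pv; rewrite lE /= inE].
exact: last_link vsc usc (trail_snoc T' pv L) L.
Qed.

Lemma adj_trail_heads a b : adjacent a b -> exists m m',
  [/\ inducing_trail a b a m m' b, a \notin an G b -> m = Head
    & b \notin an G a -> m' = Head].
Proof.
move=> /adj_trail[m [m' T]].
have [k [T' kH]] : exists k, inducing_trail a b a k m' b /\
    (a \notin an G b -> k = Head).
  have [ab|ab] := boolP (a \in an G b); first by exists m.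
  exists Head; split=> //; apply: trail_sym; rewrite setUC.
  by apply: inducing_trail_head ab; rewrite setUC; apply: trail_sym T.
have [ba|ba] := boolP (b \in an G a); first by exists k, m'.
by exists k, Head; split=> //; apply: inducing_trail_head T' ba.
Qed.

Lemma adj_open_trail Z a b : adjacent a b -> exists m m',
  [/\ open_trail Z a m m' b, a \notin an G b -> a \in Z -> m = Head
    & b \notin an G a -> b \in Z -> m' = Head].
Proof.
move=> /adj_trail_heads[m [m' [T aH bH]]].
have [k [k' [O kE k'E]]] := open_inducing Z T.
exists k, k'; split=> // [/aH <-|/bH <-]; by [].
Qed.

Lemma sc_adj a b : a != b -> a \in sc G b -> adjacent a b.
Proof.
move=> ab asc; apply: (trail_adj ab (sc_trail _ _ _ ab)).
by move: asc; rewrite !scE andbC.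
Qed.

(** A walk that enters [b] with an arrowhead can go on to [c] inside their
    component, where nothing can block it. *)
Lemma adj_sc a b c : adjacent a b -> b \notin an G a -> c \in sc G b ->
  a != c -> adjacent a c.
Proof.
move=> ab ba csc ac.
have [m [m' [T _ /(_ ba) m'H]]] := adj_trail_heads ab; subst m'.
have [<- //|bc] := eqVneq b c.
apply: (trail_adj (m := m) (m' := Head)) => //.
have -> : anS G [set a; c] = anS G [set a; b].
  move: csc; rewrite scE => /andP[cb bc'].
  apply/setP => x; rewrite !anS2; congr (_ || _).
  by apply/idP/idP => xan; apply: an_trans xan _.
exact: trail_cat T _ (sc_trail _ _ csc bc).
Qed.

(** Where an open walk from [x] and one to [c] meet in [y] outside of [Z], only
    two arrowheads at [y] can do harm.  If [y] is no ancestor of [Z], a directed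
    path from [y] to [x] or [c] is open and replaces the walk on its side. *)
Lemma extend_nsep Z x m k y c : open_trail Z x m k y -> adjacent y c ->
  x \notin Z -> y \notin Z -> c \notin Z ->
  [|| y \in an G x, y \in an G c | y \in anS G Z] ->
  ~ sigma_separated G [set x] [set c] Z.
Proof.
move=> T yc xZ yZ cZ anc.
suff [l [l' O]] : exists l l', open_trail Z x l l' c by apply: open_trail_nsep O _ _.
have [m1 [m1' [O _ _]]] := adj_open_trail Z yc.
have yN : y \in ~: Z by rewrite inE.
have [yA|yA] := boolP (y \in anS G Z).
  by exists m, m1'; apply: trail_cat T _ O; case: (k); case: (m1).
have free c' u v : y \in an G u -> dir G u v -> v \in an G c' ->
    (u \in ~: Z) || (v \in sc G u).
  by move=> yu _ _; rewrite inE; apply/orP; left; apply: contra yA => /mem_anS;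
    apply: anS_an.
move: anc; rewrite (negPf yA) orbF => /orP[yx|yc'].
  have [xE|nyx] := eqVneq y x; first by subst y; exists m1, m1'.
  have [t [_ _ /trail_sym D]] := directed_trail (anS G Z) yx nyx (free x).
  exists Head, m1'; apply: trail_cat D _ O.
  by apply: pass_N; rewrite ?(negPf (smark_tail _ _)).
have [t [_ _ D]] := directed_trail (anS G Z) yc' (adj_neq yc) (free c).
exists m, Head; apply: trail_cat T _ D.
by apply: pass_N; rewrite ?(negPf (smark_tail _ _)) ?andbF.
Qed.

(** If [c] were an ancestor of an end, an open walk between [a] and [c] could be
    extended to [b]. *)
Lemma sepset_collider Z a b c : adjacent a c -> adjacent c b ->
  a \notin Z -> b \notin Z -> c \notin Z -> sigma_separated G [set a] [set b] Z ->
  c \notin an G a /\ c \notin an G b.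
Proof.
move=> ac cb aZ bZ cZ S; have [m [m' [O _ _]]] := adj_open_trail Z ac.
by split; apply/negP => can; apply: extend_nsep O cb _ _ _ _ S => //;
  rewrite can ?orbT.
Qed.

(** Otherwise open walks from both ends would arrive at [c] with arrowheads, and
    [c] would be a collider in the separating set. *)
Lemma sepset_noncollider Z a b c : adjacent a c -> adjacent c b ->
  a \notin Z -> b \notin Z -> c \in Z -> sigma_separated G [set a] [set b] Z ->
  (c \in an G a) || (c \in an G b).
Proof.
move=> ac cb aZ bZ cZ S; apply: contraT; rewrite negb_or => /andP[nca ncb].
have [m [m' [O1 _ /(_ nca cZ) m'H]]] := adj_open_trail Z ac.
have [k [k' [O2 /(_ ncb cZ) kH _]]] := adj_open_trail Z cb.
subst m' k; have O := trail_cat O1 (mem_anS cZ : pass _ (~: Z) c Head Head) O2.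
by case: (open_trail_nsep O aZ bZ S).
Qed.

End Trails.

Notation adjacent G := (fci_adj (IM_sigma G)).

(** * Context nodes *)

Section Context.
Variables (V : finType) (G : dmg V) (K : {set V}).
Hypothesis exo : jci_sat K G Exogeneity.

Lemma an_context i k : k \in K -> i \in an G k -> i \in K.
Proof.
move=> kK; rewrite anE => /connectP[p ip kE]; rewrite {}kE in kK.
elim: p i ip kK => //= j p IH i /andP[ij jp] /(IH _ jp) jK.
by apply: contraTT ij => iK; apply: exo.
Qed.

(** An inducing path from a context node leaves the context by a directed edge.
    An inner node could not do so, as the edge leaves its component, so this is
    the first edge, and the path then follows directed edges up to an ancestor
    of the system endpoint. *)
Lemma context_an k i : jci_sat K G Randomization -> adjacent G k i ->
  k \in K -> i \notin K -> k \in an G i.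
Proof.
move=> ran ki kK iK; have [m [m' T]] := adj_trail ki.
suff H y l : trail G (anS G [set k; i]) set0 k m l y -> y \notin K ->
    k \in an G i \/ l = Head /\ k \in an G y.
  by case: (H _ _ T iK) => // -[].
have leave x y' l1 l2 : link G x l1 l2 y' -> x \in K -> y' \notin K ->
    [/\ dir G x y', l1 = Exit & l2 = Head].
  case=> -[] [E -> ->] xK yK.
  - split=> //; rewrite /smark /= scE; case: ifP => // /andP[/(an_context xK)].
    by rewrite (negPf yK).
  - by move: E; rewrite /= (negPf (exo xK yK)).
  - by move: E; rewrite /= bid_sym (negPf (ran _ _ xK yK)).
elim=> [l' v L|l' v l1 l2 u _ IH pv L] uK.
  by have [/dir_an kv _ ->] := leave _ _ _ _ L kK uK; right.
have [vK|vK] := boolP (v \in K).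
  have [_ l1E _] := leave _ _ _ _ L vK uK.
  by move: pv; rewrite l1E; case: (l'); rewrite /= inE.
case: (IH vK) => [|[l'E kv]]; first by left.
subst l'; have [hl|tl] := boolP (is_head l1).
  left; case: l1 hl pv {L} => //= _; rewrite anS2 => /orP[/(an_context kK)|].
    by rewrite (negPf vK).
  exact: an_trans.
by case: (link_tail L tl) => -> vu _; right; rewrite (an_trans kv (dir_an vu)).
Qed.

Lemma context_nan k k' : jci_sat K G Genericity -> k \in K -> k' \in K ->
  k != k' -> k \notin an G k'.
Proof.
move=> gen kK kK' nkk; apply/negP; rewrite anE => /connectP[[|t p] /= kp kE].
  by rewrite kE eqxx in nkk.
case/andP: kp => kt tp; have tK : t \in K.
  by apply: (an_context kK'); rewrite anE; apply/connectP; exists p.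
have [tE|nkt] := eqVneq k t; first by rewrite tE dir_irr in kt.
by case/andP: (gen _ _ kK tK nkt) => _; rewrite kt.
Qed.

End Context.

(** * Soundness of the orientations *)

Section Soundness.
Variables (V : finType) (G : dmg V) (sep : V -> V -> {set V}).
Hypothesis hsep : is_sepset (IM_sigma G) sep.
Implicit Types (P : pgraph V) (a b c d i j u v t x y : V) (p q : seq V).

(** What is maintained along a run.  Besides the correctness of the marks, the
    colliders of unshielded triples stay oriented: it is from their absence
    that the later rules draw conclusions. *)
Definition sound P : Prop :=
  [/\ forall i j, adj P i j = adjacent G i j,
      forall i j, into P i j -> j \notin an G i,
      forall i j, P i j = Some Tail -> j \in an G i /\ into P j i
    & forall a b c, adjacent G a b -> adjacent G b c -> a != c ->
        ~~ adjacent G a c -> b \notin sep a c -> into P a b /\ into P c b].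

Lemma sepsetP a b : a != b -> ~~ adjacent G a b ->
  [/\ a \notin sep a b, b \notin sep a b &
      sigma_separated G [set a] [set b] (sep a b)].
Proof.
move=> ab nab; have [/subsetP s] := hsep ab nab; rewrite inE => /asboolP S.
by split=> //; apply/negP => /s; rewrite !inE eqxx ?orbT.
Qed.

Section Marks.
Variables (P : pgraph V) (sP : sound P).

Lemma sound_adj i j : adj P i j = adjacent G i j.
Proof. by case: sP. Qed.

Lemma sound_nonadj i j : nonadj P i j -> i != j /\ ~~ adjacent G i j.
Proof. by rewrite /nonadj sound_adj => /andP[]. Qed.

Lemma into_nan i j : into P i j -> j \notin an G i.
Proof. by case: sP => _ + _ _; apply. Qed.

Lemma into_adj i j : into P i j -> adjacent G i j.
Proof. by rewrite -sound_adj /adj => /eqP->. Qed.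

Lemma circ_adj i j : circ P i j -> adjacent G i j.
Proof. by rewrite -sound_adj /adj => /eqP->. Qed.

Lemma circ_into i j : circ P i j -> ~~ into P i j.
Proof. by rewrite /into => /eqP->. Qed.

Lemma pdir_an i j : pdir P i j -> i \in an G j.
Proof. by case: sP => _ _ H _ /andP[_ /eqP/H[]]. Qed.

Lemma pdir_into i j : pdir P i j -> into P i j.
Proof. by case/andP. Qed.

Lemma connect_pdir_an i j : connect (pdir P) i j -> i \in an G j.
Proof.
rewrite anE; apply: connect_sub => x y /pdir_an; by rewrite anE.
Qed.

Lemma noncollider_an a b c : adjacent G a b -> adjacent G c b -> nonadj P a c ->
  ~~ into P c b -> (b \in an G a) || (b \in an G c).
Proof.
rewrite [adjacent G c b]adj_sym => ab bc /sound_nonadj[ac nac] ncb.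
have [aZ cZ S] := sepsetP ac nac.
apply: (sepset_noncollider ab bc aZ cZ _ S); apply: contraNT ncb => bZ.
by case: sP => _ _ _ /(_ a b c ab bc ac nac bZ)[].
Qed.

Lemma sound_arrow a c : adjacent G a c -> c \notin an G a ->
  sound (set_mark P a c Arrow).
Proof.
move=> ac ca; case: sP => [hadj hin htl hcol].
have keep i j : into P i j -> into (set_mark P a c Arrow) i j.
  by rewrite /into /set_mark; case: ifP.
split=> [i j|i j|i j|x y z].
- rewrite -hadj /adj /set_mark; case: ifP => // /andP[/eqP-> /eqP->].
  by rewrite -/(adj P a c) hadj ac.
- rewrite /into /set_mark; case: ifP => [/andP[/eqP-> /eqP->] //|_].
  exact: hin.
- rewrite /set_mark; case: ifP => // _ /htl[ij ji]; split=> //.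
  exact: keep.
- by move=> *; case: (hcol x y z) => //; split; apply: keep.
Qed.

Lemma sound_dir b c : adjacent G b c -> b \in an G c -> c \notin an G b ->
  sound (orient_dir P b c).
Proof.
move=> bc bac cab; case: sP => [hadj hin htl hcol].
have nbc : (b == c) = false by apply: negbTE; apply: adj_neq bc.
have keep i j : into P i j -> into (orient_dir P b c) i j.
  rewrite /orient_dir /into /set_mark; case: ifP => [/andP[/eqP-> /eqP->]|_].
    by move/hin; rewrite bac.
  by case: ifP.
split=> [i j|i j|i j|x y z].
- rewrite -hadj /adj /orient_dir /set_mark.
  case: ifP => [/andP[/eqP-> /eqP->]|_]; first by rewrite -/(adj P c b) hadj adj_sym bc.
  by case: ifP => // /andP[/eqP-> /eqP->]; rewrite -/(adj P b c) hadj bc.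
- rewrite /into /orient_dir /set_mark; case: ifP => // _.
  by case: ifP => [/andP[/eqP-> /eqP->] //|_]; apply: hin.
- rewrite {1}/orient_dir /set_mark; case: ifP => [/andP[/eqP-> /eqP->] _|_].
    by rewrite /into /orient_dir /set_mark nbc /= !eqxx.
  by case: ifP => // _ /htl[ij ji]; split=> //; apply: keep.
- by move=> *; case: (hcol x y z) => //; split; apply: keep.
Qed.

End Marks.

Lemma sound_bid P a b : sound P -> adjacent G a b -> a \notin an G b ->
  b \notin an G a -> sound (orient_bid P a b).
Proof.
by move=> sP ab nab nba; apply: sound_arrow; [apply: sound_arrow|rewrite adj_sym|].
Qed.

Lemma sound_R0 : sound (R0 sep (skeleton (IM_sigma G))).
Proof.
set Q := skeleton _.
have adjQ i j : adj Q i j = adjacent G i j by rewrite /adj /Q /skeleton; case: ifP.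
have nadjQ i j : nonadj Q i j = (i != j) && ~~ adjacent G i j.
  by rewrite /nonadj adjQ.
have skE i j : Q i j = if adjacent G i j then Some Circle else None by [].
have R0E i j : R0 sep Q i j = Some Arrow \/ R0 sep Q i j = Q i j.
  by rewrite /R0; case: ifP; [left|right].
split=> [i j|a c|i j|a b c].
- rewrite -adjQ /adj /R0; case: ifP => // /existsP[b /and4P[ij _ _ _]].
  by rewrite -/(adj Q i j) ij.
- rewrite /into /R0; case: ifP => [/existsP[b]|_]; last by rewrite skE; case: ifP.
  rewrite !adjQ nadjQ => /and4P[ac cb /andP[ab nab] /orP[cZ|cZ]] _.
    have [aZ bZ S] := sepsetP ab nab.
    by have [] := sepset_collider ac cb aZ bZ cZ S.
  rewrite eq_sym in ab; rewrite adj_sym in nab; have [bZ aZ S] := sepsetP ab nab.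
  rewrite adj_sym in ac; rewrite adj_sym in cb.
  by have [] := sepset_collider cb ac bZ aZ cZ S.
- by case: (R0E i j) => -> //; rewrite skE; case: ifP.
- move=> ab bc ac nac bZ; rewrite /into /R0; split.
    case: ifP => // /existsP[]; exists c.
    by rewrite !adjQ nadjQ ab bc ac nac bZ.
  case: ifP => // /existsP[]; exists a.
  rewrite !adjQ nadjQ (adj_sym G c b) (adj_sym G b a) (adj_sym G c a) eq_sym.
  by rewrite ab bc ac nac bZ orbT.
Qed.

Lemma sound_background P (K : {set V}) (S : seq jci) :
  S \in [:: [::]; [:: Exogeneity]; [:: Exogeneity; Randomization];
            [:: Exogeneity; Randomization; Genericity]] ->
  (forall r : jci, r \in S -> jci_sat K G r) ->
  (forall i j, P i j != Some Tail) -> sound P -> sound (background S K P).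
Proof.
move=> hS hG noTail sP; have [hadj hin _ hcol] := sP.
have RE : Randomization \in S -> Exogeneity \in S.
  by move: hS; rewrite !inE => /or4P[] /eqP->.
have GE : Genericity \in S -> Exogeneity \in S.
  by move: hS; rewrite !inE => /or4P[] /eqP->.
pose B := background S K P.
have spec u v : (B u v = P u v) \/ (adjacent G u v /\
    (B u v = Some Arrow /\ v \notin an G u \/
     [/\ B u v = Some Tail, B v u = Some Arrow & v \in an G u])).
  rewrite /B /background; case: ifP => [/and4P[gS uK vK uv]|_].
    right; have gen := hG _ gS; have exo := hG _ (GE gS).
    split; last by left; split=> //; apply: (context_nan exo) => //; rewrite eq_sym.
    apply: (@trail_adj _ _ _ Head Head) => //; apply: trail_link.
    by exists Bid; split=> //=; case/andP: (gen _ _ uK vK uv).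
  case: ifP => [/andP[uv eS]|_]; last by left.
  have exo := hG _ eS; rewrite hadj in uv.
  case: ifP => [/andP[uK vK]|_].
    right; split=> //; left; split=> //; apply: contra vK.
    exact: an_context exo _ _ uK.
  case: ifP => [/and3P[rS uK vK]|_]; last by left.
  right; split=> //; right; split=> //; last first.
    apply: (context_an exo) => //; [exact: hG|by rewrite adj_sym].
  by rewrite (negPf uK) !andbF hadj adj_sym uv eS vK.
have keep u v : into P u v -> into B u v.
  rewrite /into => /[dup] /hin vu; case: (spec u v) => [-> //|[_]].
  by case=> [[-> //]|[_ _]]; rewrite (negPf vu).
split=> [i j|i j|i j|a b c]; rewrite -/B.
- case: (spec i j) => [E|[ij [[E _]|[E _ _]]]];
    by rewrite -?hadj /adj E // -/(adj P i j) hadj ij.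
- rewrite /into; case: (spec i j) => [->|[_ [[_ ji]|[-> _ _]]]] //.
  exact: hin.
- case: (spec i j) => [->|[_ [[->]|[_ ji ij]]]] //.
    by move=> tl; case/eqP: (noTail i j).
  by rewrite /into ji.
- by move=> *; case: (hcol a b c) => //; split; apply: keep.
Qed.

Lemma collider_seq_cons P x y q t : collider_seq P (x :: y :: rcons q t) =
  [&& into P x y, into P (head t q) y & collider_seq P (y :: rcons q t)].
Proof. by case: q => [|z q]; rewrite /collider_seq /= -?andbA. Qed.

(** On a discriminating path all nodes before [b] belong to the separating set
    of its endpoints: an open walk from [x] to the first one that did not could
    be extended to [c], as that node is a parent of [c].  So the walk from [x]
    to the predecessor of [b] is open, and it arrives there with an arrowhead. *)
Lemma discriminating_open P x q b c : sound P -> discriminating_path P x q b c ->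
  [/\ last x q \in sep x c, into P b (last x q), pdir P (last x q) c &
      exists m, trail G (anS G (sep x c)) (~: sep x c) x m Head (last x q)].
Proof.
move=> sP /and5P[q0 + U nxc /andP[cq dq]].
rewrite cat_path => /andP[xq _].
have [xc nac] := sound_nonadj sP nxc; have [xZ cZ S] := sepsetP xc nac.
set Z := sep x c in xZ cZ S *.
have xq' : last x q != x.
  case: q q0 U {xq cq dq} => // v q _ /= /andP[xq _]; apply: contraNneq xq => <-.
  by rewrite -cat_cons mem_cat mem_last.
pose inv y t := y = x \/ [/\ y \in Z, into P t y, pdir P y c &
  exists m, trail G (anS G Z) (~: Z) x m Head y].
suff H y : path (adj P) y q -> collider_seq P (y :: rcons q b) -> inv y (head b q) ->
    inv (last y q) b.
  by case: (H x xq cq (or_introl erefl)) => // xE; rewrite xE eqxx in xq'.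
elim: q y dq {q0 U cq xq xq'} => // v q IH y /= /andP[vc dq] /andP[yv vq].
rewrite collider_seq_cons => /and3P[iyv itv cq] invy; apply: IH => //; right.
rewrite (sound_adj sP) in yv.
have [m [m' [O yH vH]]] := adj_open_trail Z yv.
have vny := into_nan sP iyv.
have [l [l' [O' l'H]]] : exists l l', trail G (anS G Z) (~: Z) x l l' v /\
    (v \in Z -> l' = Head).
  case: invy => [yE|[yZ ivy _ [l T]]].
    by subst y; exists m, m'; split=> //; apply: vH.
  exists l, m'; split; last exact: vH.
  apply: trail_cat T _ O; rewrite (yH (into_nan sP ivy) yZ).
  exact: mem_anS.
have vZ : v \in Z.
  apply: contraT => nvZ; case: (extend_nsep O' _ xZ nvZ cZ _ S).
    exact: (into_adj sP (pdir_into vc)).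
  by rewrite (pdir_an sP vc) orbT.
by split=> //; exists l; rewrite -(l'H vZ).
Qed.

Lemma sound_rule1_4 P P' : sound P -> rule1_4 sep P P' -> sound P'.
Proof.
move=> sP; case.
- move=> a b c iab ccb nac.
  have [ac nadj] := sound_nonadj sP nac; have bna := into_nan sP iab.
  have ab := into_adj sP iab; have cb := circ_adj sP ccb.
  have bc : b \in an G c.
    have := noncollider_an sP ab cb nac (circ_into ccb).
    by rewrite (negPf bna).
  apply: sound_dir => //; first by rewrite adj_sym.
  (* Otherwise [a] would be adjacent to [c], in the component of [b]. *)
  apply: contra nadj => cab; apply: (adj_sc ab bna) => //.
  by rewrite scE cab bc.
- move=> a b c H cac; apply: sound_arrow => //; first exact: circ_adj cac.
  case/orP: H => /andP[].
    move=> /(pdir_an sP) ab /(into_nan sP) cb; apply: contra cb => ca.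
    exact: an_trans ca ab.
  move=> /(into_nan sP) ba /(pdir_an sP) bc; apply: contra ba => ca.
  exact: an_trans bc ca.
- move=> a b c d iab icb cad ccd nac cdb.
  apply: sound_arrow => //; first exact: circ_adj cdb.
  have := noncollider_an sP (circ_adj sP cad) (circ_adj sP ccd) nac (circ_into ccd).
  case/orP=> [da|dc].
    by apply: contra (into_nan sP iab) => bd; apply: an_trans bd da.
  by apply: contra (into_nan sP icb) => bd; apply: an_trans bd dc.
- move=> x q b c D ccb bZ.
  have [aZ iba /(pdir_an sP) ac [m T]] := discriminating_open sP D.
  set a := last x q in aZ iba ac T; have ab := into_nan sP iba.
  have [xc nac] : x != c /\ ~~ adjacent G x c.
    by case/and5P: D => _ _ _ /(sound_nonadj sP).
  have [xZ cZ S] := sepsetP xc nac.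
  have bc : adjacent G b c by rewrite adj_sym (circ_adj sP).
  have adjab : adjacent G a b by rewrite adj_sym (into_adj sP).
  have [k [k' [O1 aH bH]]] := adj_open_trail (sep x c) adjab.
  have [l [l' [O2 bH' _]]] := adj_open_trail (sep x c) bc.
  have bac : b \in an G c.
    (* Otherwise [b] is a collider in the separating set, like those before. *)
    apply: contraT => nbc; have nba : b \notin an G a.
      by apply: contra nbc => ba; apply: an_trans ba ac.
    have aA : pass (anS G (sep x c)) (~: sep x c) a Head k.
      by rewrite aH //; apply: mem_anS.
    have bA : pass (anS G (sep x c)) (~: sep x c) b k' l.
      by rewrite bH // bH' //; apply: mem_anS.
    by case: (open_trail_nsep (trail_cat (trail_cat T aA O1) bA O2) xZ cZ S).
  apply: sound_dir => //.
  by apply: contra ab => cab; apply: an_trans ac cab.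
- move=> x q b c D ccb bZ.
  have [aZ iba /(pdir_an sP) ac [m T]] := discriminating_open sP D.
  set a := last x q in aZ iba ac T *; have ab := into_nan sP iba.
  have [xc nac] : x != c /\ ~~ adjacent G x c.
    by case/and5P: D => _ _ _ /(sound_nonadj sP).
  have [xZ cZ S] := sepsetP xc nac.
  have bc : adjacent G b c by rewrite adj_sym (circ_adj sP).
  have adjab : adjacent G a b by rewrite adj_sym (into_adj sP).
  have [k [k' [O1 aH _]]] := adj_open_trail (sep x c) adjab.
  have nbc : b \notin an G c.
    (* Otherwise the open walk to [b] could be extended to [c]. *)
    apply/negP => bac.
    have aA : pass (anS G (sep x c)) (~: sep x c) a Head k.
      by rewrite aH //; apply: mem_anS.
    apply: (extend_nsep (trail_cat T aA O1) bc xZ bZ cZ _ S).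
    by rewrite bac orbT.
  apply: sound_bid => //; last by apply: contra ab => cab; apply: an_trans ac cab.
  apply: sound_bid => //.
  by apply: contra nbc => ba; apply: an_trans ba ac.
Qed.

Lemma possdir_adj P i j : sound P -> possdir P i j -> adjacent G i j.
Proof.
move=> sP /or3P[/andP[/(circ_adj sP)//]|/andP[/(into_adj sP)//]|].
by move/pdir_into/(into_adj sP).
Qed.

Lemma possdir_into P i j : possdir P i j -> ~~ into P j i.
Proof.
case/or3P=> /andP[_]; [exact: circ_into|exact: circ_into|].
by rewrite /into => /eqP->.
Qed.

(** If the first node of an uncovered possibly directed path is an ancestor of
    the second one and in another component, then this propagates: an inner node
    is no collider, hence an ancestor of its successor, and were that in its
    component, the nodes on both sides would be adjacent. *)
Lemma uncovered_an P a b p : sound P -> uncovered_possdir_path P a (b :: p) ->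
  a \in an G b -> b \notin an G a -> a \in an G (last b p).
Proof.
move=> sP; elim: p a b => // d p IH a b.
case/and3P=> /= /and3P[ab bd dp] /andP[_ U] /andP[nad al] aab nba.
have [ad nadj] := sound_nonadj sP nad.
have adjab := possdir_adj sP ab; have adjbd := possdir_adj sP bd.
have abd : b \in an G d.
  rewrite adj_sym in adjbd.
  have := noncollider_an sP adjab adjbd nad (possdir_into bd).
  by rewrite (negPf nba).
apply: (an_trans aab); apply: IH => //.
  by apply/and3P; split; rewrite //= bd dp.
apply: contra nadj => db; apply: (adj_sc adjab nba) ad.
by rewrite scE db abd.
Qed.

Lemma sound_rule8_10 P P' : sound P -> rule8_10 P P' -> sound P'.
Proof.
move=> sP; case.
- move=> a b c /(pdir_an sP) ab /(pdir_an sP) bc /andP[iac _].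
  apply: sound_dir (into_adj sP iac) _ (into_nan sP iac) => //.
  exact: an_trans ab bc.
- move=> a b c p /andP[iac cca] U pE nbc.
  have cna := into_nan sP iac; have ac := into_adj sP iac.
  apply: sound_dir => //; apply: contraT => nac.
  have [bc nadj] := sound_nonadj sP nbc.
  have adjab : adjacent G a b.
    by case/and3P: U => /= /andP[/(possdir_adj sP)].
  have ab : a \in an G b.
    have adjba : adjacent G b a by rewrite adj_sym.
    have adjca : adjacent G c a by rewrite adj_sym.
    have := noncollider_an sP adjba adjca nbc (circ_into cca).
    by rewrite (negPf nac) orbF.
  suff : a \in an G c by rewrite (negPf nac).
  rewrite -pE; apply: (uncovered_an sP U ab).
  (* Were [b] in the component of [a], it would be adjacent to [c]. *)
  apply: contra nadj => ba; rewrite adj_sym.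
  have adjca : adjacent G c a by rewrite adj_sym.
  by apply: (adj_sc adjca nac); rewrite 1?eq_sym // scE ba ab.
- move=> a b c d m1 p1 m2 p2 /andP[iac _] bc dc U1 E1 U2 E2 n12.
  have adj_first m p : uncovered_possdir_path P a (m :: p) -> adjacent G m a.
    by case/and3P=> /= /andP[/(possdir_adj sP)]; rewrite adj_sym.
  have key m p n q : uncovered_possdir_path P a (m :: p) -> pdir P (last m p) c ->
      uncovered_possdir_path P a (n :: q) -> pdir P (last n q) c ->
      m != n -> ~~ adjacent G m n -> a \in an G m -> a \in an G c.
    move=> Um mc Un nc mn nadj am; have [ma|nma] := boolP (m \in an G a); last first.
      exact: an_trans (uncovered_an sP Um am nma) (pdir_an sP mc).
    (* If [m] is in the component of [a], then [n] would be adjacent to [m] both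
       if it were in that component and if [a] were no ancestor of it.  So the
       other path starts by leaving the component. *)
    have msc : m \in sc G a by rewrite scE ma am.
    have an' : a \in an G n.
      apply: contraT => nan; case/negP: nadj; rewrite adj_sym.
      by apply: (adj_sc (adj_first _ _ Un) nan msc); rewrite eq_sym.
    have nna : n \notin an G a.
      apply: contra nadj => na; apply: (sc_adj mn).
      by rewrite scE (an_trans ma an') (an_trans na am).
    exact: an_trans (uncovered_an sP Un an' nna) (pdir_an sP nc).
  have [m12 nadj] := sound_nonadj sP n12.
  apply: sound_dir (into_adj sP iac) _ (into_nan sP iac) => //.
  have pd2 : possdir P a m2 by case/and3P: U2 => /= /andP[].
  have := noncollider_an sP (adj_first _ _ U1) (adj_first _ _ U2) n12.
  have nia : ~~ into P m2 a by apply: possdir_into.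
  rewrite -E1 in bc; rewrite -E2 in dc.
  move=> /(_ nia)/orP[]; first exact: key U1 bc U2 dc m12 nadj.
  by apply: key U2 dc U1 bc _ _; rewrite 1?eq_sym 1?adj_sym.
Qed.

(** * The output is a DPAG that contains the graph *)

Section Output.
Variables (P : pgraph V) (sP : sound P).

(** The inducing paths behind the edges of the path can be chosen with
    arrowheads at its inner nodes, because these are colliders; as ancestors of
    the endpoints they then satisfy the condition on the concatenation. *)
Lemma sound_pag_inducing_path i j p : i != j -> pag_inducing_path P i j p ->
  adjacent G i j.
Proof.
move=> ij /and5P[ip _ /eqP E cp al].
pose B := anS G [set i; j].
have iB : i \in B by rewrite mem_anS ?set21.
have jB : j \in B by rewrite mem_anS ?set22.
suff H : forall q y v, adj P y v -> path (adj P) v q -> collider_seq P (y :: v :: q) ->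
    all (fun '(_, v, _) => v \in B) (triples (y :: v :: q)) -> last v q = j ->
    y = i \/ [/\ y \in B, into P v y & exists m, trail G B set0 i m Head y] ->
    exists m m', trail G B set0 i m m' j.
  case: p ip E cp al => [_ /eqP|v p /andP[iv vp] E cp al].
    by rewrite (negPf ij).
  have [||m [m' T]] := H p i v iv vp cp _ E; [|by left|exact: trail_adj ij T].
  apply: sub_all al => -[[_ u] _]; rewrite anS2.
  by case/orP=> /(connect_pdir_an sP) ->; rewrite ?orbT.
have step y v : adj P y v -> v \in B ->
    y = i \/ [/\ y \in B, into P v y & exists m, trail G B set0 i m Head y] ->
    exists m m', trail G B set0 i m m' v /\ (v \notin an G y -> m' = Head).
  rewrite (sound_adj sP) => /adj_trail_heads[m [m' [T yH vH]]] vB invy.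
  have yB : y \in B by case: invy => [->|[]].
  have {}T : trail G B set0 y m m' v.
    apply: sub_trail T => //; apply/subsetP => x; rewrite anS2.
    by case/orP=> /anS_an; apply.
  case: invy => [yE|[_ ivy [l T']]]; first by subst y; exists m, m'.
  exists l, m'; split=> //; apply: trail_cat T' _ T.
  by rewrite (yH (into_nan sP ivy)).
elim=> [|t q IH] y v yv vq cq alq E' invy.
  have [|m [m' [T _]]] := step y v yv _ invy; first by rewrite [v]E'.
  by exists m, m'; rewrite -[X in trail _ _ _ _ _ _ X]E'.
case/andP: alq => vB alq; case/andP: cq => /andP[iyv itv] cq.
case/andP: vq => vt tq; apply: (IH v t) => //; right; split=> //.
have [m [m' [T m'H]]] := step y v yv vB invy.
by exists m; rewrite -(m'H (into_nan sP iyv)).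
Qed.

Lemma sound_contains : contains P G.
Proof.
split=> [i j ij|i j /(into_nan sP)//|i j /(pdir_an sP)//].
rewrite (sound_adj sP); split; first exact: adj_inducing_path.
by case=> w /(inducing_path_trail ij)[m [m' T]]; apply: trail_adj ij T.
Qed.

Lemma sound_is_dpag : is_dpag P.
Proof.
have irr i : P i i = None.
  apply/eqP; rewrite -[_ == _]negbK -/(adj P i i) (sound_adj sP).
  by apply/negP => /adj_neq; rewrite eqxx.
have sym i j : adj P i j = adj P j i by rewrite !(sound_adj sP) adj_sym.
split; [split=> // i j ij| | |].
- have ji : adj P j i by rewrite sym.
  have tl u v : P u v = Some Tail -> P v u = Some Arrow.
    by case: sP => _ _ H _ /H[_ /eqP].
  move: ij ji (tl i j) (tl j i).
  rewrite /adj /pdir /pbid /oarrow /ocirc /into /circ.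
  by case: (P i j) => [[]|] //; case: (P j i) => [[]|] //= _ _ tij tji;
    by [move: (tij erefl) | move: (tji erefl)].
- move=> i j /(connect_pdir_an sP) ij; apply/negP => /(pdir_into)/(into_nan sP).
  by rewrite ij.
- move=> i j /(connect_pdir_an sP) ij; apply/negP => /andP[/(into_nan sP)].
  by rewrite ij.
- move=> i j p /(sound_nonadj sP)[ij nij]; apply: contra nij.
  exact: sound_pag_inducing_path.
Qed.

End Output.

End Soundness.

(** * Termination *)

Section Termination.
Variables (V : finType) (sep : V -> V -> {set V}).
Implicit Types (P : pgraph V).

Definition circles P : {set V * V} := [set e | circ P e.1 e.2].

Lemma exhaust_ex (rule : pgraph V -> pgraph V -> Prop) :
  (forall P P', rule P P' -> #|circles P'| < #|circles P|) ->
  forall P, exists P', exhaust rule P P'.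
Proof.
move=> dec P; have [n] := ubnP #|circles P|; elim: n P => // n IH P lePn.
have [[P' PP']|stuck] := pselect (exists P', rule P P').
  have [|P2 [run norm]] := IH P'; first exact: leq_trans (dec _ _ PP') lePn.
  by exists P2; split=> //; apply: rt_trans run; apply: rt_step.
by exists P; split=> [|P' PP']; [apply: rt_refl|apply: stuck; exists P'].
Qed.

Lemma circles_lt P P' a b : circ P a b -> ~~ circ P' a b ->
  (forall i j, circ P' i j -> circ P i j) -> #|circles P'| < #|circles P|.
Proof.
move=> ab nab sub; apply: proper_card; apply/properP; split.
  by apply/subsetP => e; rewrite !inE; apply: sub.
by exists (a, b); rewrite inE.
Qed.

Lemma circ_set_mark P a b m i j : m != Circle ->
  circ (set_mark P a b m) i j = circ P i j && ~~ ((i == a) && (j == b)).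
Proof.
move=> mC; rewrite /circ /set_mark; case: ifP => _; rewrite ?andbT // andbF.
by apply/negbTE; apply: contra mC => /eqP[->].
Qed.

Lemma rule1_4_circles P P' : rule1_4 sep P P' -> #|circles P'| < #|circles P|.
Proof.
case.
- move=> a b c _ cb _; apply: (circles_lt cb) => [|i j];
    by rewrite !circ_set_mark // ?eqxx ?andbF // => /andP[/andP[]].
- move=> a b c _ ac; apply: (circles_lt ac) => [|i j];
    by rewrite !circ_set_mark // ?eqxx ?andbF // => /andP[].
- move=> a b c d _ _ _ _ _ db; apply: (circles_lt db) => [|i j];
    by rewrite !circ_set_mark // ?eqxx ?andbF // => /andP[].
- move=> x q b c _ cb _; apply: (circles_lt cb) => [|i j];
    by rewrite !circ_set_mark // ?eqxx ?andbF // => /andP[/andP[]].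
- move=> x q b c _ cb _; apply: (circles_lt cb) => [|i j];
    by rewrite !circ_set_mark // ?eqxx ?andbF // => /andP[/andP[/andP[/andP[]]]].
Qed.

Lemma rule8_10_circles P P' : rule8_10 P P' -> #|circles P'| < #|circles P|.
Proof.
have dec a c : oarrow P a c -> #|circles (orient_dir P a c)| < #|circles P|.
  case/andP=> _ ca; apply: (circles_lt ca) => [|i j];
    by rewrite !circ_set_mark // ?eqxx ?andbF // => /andP[/andP[]].
by case=> *; apply: dec.
Qed.

End Termination.

Lemma clos_invariant (T : Type) (rule : T -> T -> Prop) (Q : T -> Prop) x y :
  (forall x y, Q x -> rule x y -> Q y) ->
  clos_refl_trans _ rule x y -> Q x -> Q y.
Proof. by move=> inv; elim=> //; eauto. Qed.

Theorem corollary2 (V : finType) (K : {set V}) (S : seq jci)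
    (hS : S \in [:: [::]; [:: Exogeneity]; [:: Exogeneity; Randomization];
                    [:: Exogeneity; Randomization; Genericity]])
    (G : dmg V) (hG : forall a, a \in S -> jci_sat K G a)
    (sep : V -> V -> {set V}) (hsep : is_sepset (IM_sigma G) sep) :
  (exists P : pgraph V, fci_jci (IM_sigma G) sep S K P) /\
  (forall P : pgraph V, fci_jci (IM_sigma G) sep S K P ->
     is_dpag P /\ contains P G).
Proof.
split.
  have [P1 run1] := exhaust_ex (@rule1_4_circles V sep)
    (background S K (R0 sep (skeleton (IM_sigma G)))).
  by have [P run2] := exhaust_ex (@rule8_10_circles V) P1; exists P, P1.
move=> P [P1 [[run1 _] [run2 _]]].
have s0 : sound G sep (background S K (R0 sep (skeleton (IM_sigma G)))).
  apply: sound_background hS hG _ (sound_R0 hsep) => i j.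
  by rewrite /R0 /skeleton; case: ifP => // _; case: ifP.
have s1 := clos_invariant (Q := sound G sep) (@sound_rule1_4 _ _ _ hsep) run1 s0.
have s2 := clos_invariant (Q := sound G sep) (@sound_rule8_10 _ _ _ hsep) run2 s1.
by split; [apply: sound_is_dpag s2|apply: sound_contains s2].
Qed.
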